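(* The objective function $S \mapsto \lambda(S)$ of the problem of maximizing the smallest eigenvalue of the grounded Laplacian matrix is not submodular in general. That is, there exist a connected, undirected, unweighted graph $\mathcal{G}=(V,E)$, nonempty sets $A \subseteq B \subsetneq V$, and a node $v \in V$ such that $B\cup\{v\} \subsetneq V$ and $$\lambda(A\cup\{v\})-\lambda(A) < \lambda(B\cup\{v\})-\lambda(B).$$
   Context: For a finite, simple, connected, undirected, unweighted graph $\mathcal{G}=(V,E)$ with adjacency matrix $\boldsymbol{A}$ (with $0/1$ entries) and diagonal degree matrix $\boldsymbol{D}$, the Laplacian matrix is $\boldsymbol{L}=\boldsymbol{D}-\boldsymbol{A}$. For a nonempty proper subset $S\subsetneq V$ (the grounded nodes), the grounded Laplacian matrix $\boldsymbol{L}(S)$ is the principal submatrix of $\boldsymbol{L}$ obtained by deleting the rows and columns corresponding to the nodes in $S$, and $\lambda(S)$ denotes the smallest eigenvalue of $\boldsymbol{L}(S)$. The optimization problem in question is: given $\mathcal{G}$ and a positive integer $k$, maximize $\lambda(S)$ over all $S\subset V$ with $|S|=k$. A set function $f:2^V\to\mathbb{R}$ is submodular if $f(S\cup\{u\})-f(S)\ge f(T\cup\{u\})-f(T)$ for all $S\subseteq T\subseteq V$ and $u\in V$. *)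

(* Defs.v *)
From HB Require Import structures.
From mathcomp Require Import all_boot all_order all_algebra.
From mathcomp Require Import classical_sets reals.
From mathcomp Require Import polyrcf complex.

Set Implicit Arguments.
Unset Strict Implicit.
Unset Printing Implicit Defensive.

Import Order.TTheory GRing.Theory Num.Theory.
Local Open Scope ring_scope.

(* The vertex set is {0, ..., n-1}; [e] is the adjacency relation. *)
Definition connected_simple_graph (n : nat) (e : rel 'I_n) : Prop :=
  [/\ symmetric e, irreflexive e & forall x y : 'I_n, connect e x y].

Definition adjacency_mx (R : pzRingType) (n : nat) (e : rel 'I_n) : 'M[R]_n :=
  \matrix_(i, j) (e i j)%:R.

Definition degree_mx (R : pzRingType) (n : nat) (e : rel 'I_n) : 'M[R]_n :=
  diag_mx (\row_i #|[set j | e i j]|%:R).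

Definition laplacian_mx (R : pzRingType) (n : nat) (e : rel 'I_n) : 'M[R]_n :=
  degree_mx R e - adjacency_mx R e.

(* The rows and columns that are kept, those outside [S], are reindexed by
   ['I_#|~: S|] through the enumeration of [~: S]. *)
Definition grounded_laplacian_mx (R : pzRingType) (n : nat) (e : rel 'I_n)
    (S : {set 'I_n}) : 'M[R]_#|~: S| :=
  let keep := fun i : 'I_#|~: S| => enum_val i in
  mxsub keep keep (laplacian_mx R e).

Definition smallest_eigenvalue (R : realType) (m : nat) (M : 'M[R]_m) (a : R) :
    Prop :=
  eigenvalue M a /\ (forall b : R, eigenvalue M b -> a <= b).

(* The default value 0 is reached only if [S] is the whole vertex set,
   see [grounded_eigenvalueP]. *)
Definition grounded_eigenvalue (R : realType) (n : nat) (e : rel 'I_n)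
    (S : {set 'I_n}) : R :=
  xget 0 [set a | smallest_eigenvalue (grounded_laplacian_mx R e S) a]%classic.

Lemma smallest_eigenvalue_uniq (R : realType) (m : nat) (M : 'M[R]_m) (a b : R) :
  smallest_eigenvalue M a -> smallest_eigenvalue M b -> a = b.
Proof.
by move=> [Ma mina] [Mb minb]; apply/le_anti; rewrite mina //= minb.
Qed.

Lemma symmetric_eigenvalue_exists (R : realType) (m : nat) (M : 'M[R]_m) :
  (0 < m)%N -> M^T = M -> exists a : R, eigenvalue M a.
Proof.
move=> m_gt0 symM; pose f := real_complex R.
have [z /eigenvalueP[v vM vn0]] := eigenvalue_closed (map_mx f M) m_gt0.
pose w : 'cV_m := map_mx Num.conj v^T.
have conjf : map_mx Num.conj (map_mx f M) = map_mx f M.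
  by apply/matrixP => i j; rewrite !mxE; apply/CrealP/complex_realP; exists (M i j).
have Mw : map_mx f M *m w = z^* *: w.
  have := congr1 (fun u => map_mx Num.conj u^T) vM.
  by rewrite trmx_mul map_trmx symM map_mxM conjf linearZ map_mxZ.
have vw_neq0 : (v *m w) 0 0 != 0.
  rewrite mxE; apply: contra vn0 => /eqP /psumr_eq0P v0.
  apply/eqP/rowP => j; rewrite mxE.
  have /v0/(_ j isT)/eqP : forall i : 'I_m, true -> 0 <= v 0 i * w i 0.
    by move=> i _; rewrite !mxE mul_conjC_ge0.
  by rewrite !mxE mul_conjC_eq0 => /eqP.
have /CrealP/complex_realP[a za] : z^* = z.
  apply: (mulIf vw_neq0); have := mulmxA v (map_mx f M) w.
  by rewrite Mw vM -scalemxAr -scalemxAl => /matrixP/(_ 0 0); rewrite !mxE.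
exists a; rewrite eigenvalue_root_char -(fmorph_root f) map_char_poly.
by rewrite -eigenvalue_root_char; apply/eigenvalueP; exists v; rewrite // vM za.
Qed.

Lemma symmetric_smallest_eigenvalue (R : realType) (m : nat) (M : 'M[R]_m) :
  (0 < m)%N -> M^T = M -> exists a : R, smallest_eigenvalue M a.
Proof.
move=> m_gt0 symM; have [a Ma] := symmetric_eigenvalue_exists m_gt0 symM.
have p_neq0 : char_poly M != 0 by rewrite monic_neq0 ?char_poly_monic.
have eigE b : eigenvalue M b = (b \in rootsR (char_poly M)).
  by rewrite -roots_on_rootsR // eigenvalue_root_char.
move: Ma; rewrite eigE => /seq_tnthP[i _].
case: (arg_minP (tnth (in_tuple (rootsR (char_poly M)))) (erefl : xpredT i)).
move=> j _ minj; exists (tnth (in_tuple (rootsR (char_poly M))) j); split.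
  by rewrite eigE mem_tnth.
by move=> b; rewrite eigE => /(tnthP (in_tuple _))[k ->]; apply: minj.
Qed.

Lemma grounded_eigenvalueP (R : realType) (n : nat) (e : rel 'I_n)
    (S : {set 'I_n}) :
  symmetric e -> S \proper [set: 'I_n] ->
  smallest_eigenvalue (grounded_laplacian_mx R e S) (grounded_eigenvalue R e S).
Proof.
move=> sym_e /properP[_ [x _ xS]]; apply: xgetPex.
apply: symmetric_smallest_eigenvalue.
  by rewrite card_gt0; apply/set0Pn; exists x; rewrite inE.
rewrite trmx_mxsub linearB /= tr_diag_mx; congr (mxsub _ _ (_ - _)).
by apply/matrixP => i j; rewrite !mxE sym_e.
Qed.

(* Main.v *)
Require Import Defs.
From mathcomp Require Import all_boot all_order all_algebra.
From mathcomp Require Import reals.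

Import Order.TTheory GRing.Theory Num.Theory.
Local Open Scope ring_scope.

(** Let every vertex outside [S] have at least [c] neighbours in [S].  Reading
the eigenvector equation at an entry of largest modulus gives [c <= lambda(S)];
conversely, if [T] is a union of components of the graph without [S] all of
whose vertices have exactly [c] neighbours in [S], the indicator of [T] is an
eigenvector for [c], so [lambda(S) <= c].  In the paw graph (a triangle 0, 1, 2
with a pendant vertex 3 attached to 0), take [A = {0}], [B = {0, 3}], [v = 1].
Grounding 1 on top of [A] does not help because the component [{3}] keeps the
eigenvalue at 1, whereas on top of [B] it raises the eigenvalue from 1 to 2. *)

(** Row vectors are given by functions on all vertices, so that an entry of the product becomes a
    sum over neighbours, free of the reindexing of [~: S]. *)
Lemma mul_grounded_laplacian_mxE (R : pzRingType) (n : nat) (e : rel 'I_n)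
    (S : {set 'I_n}) (y : 'I_n -> R) (j : 'I_#|~: S|) :
  ((\row_i y (enum_val i)) *m grounded_laplacian_mx R e S) 0 j =
  y (enum_val j) * #|[set k | e (enum_val j) k]|%:R
    - \sum_(i in ~: S | e i (enum_val j)) y i.
Proof.
rewrite mxE.
pose F i := y i * laplacian_mx R e i (enum_val j).
transitivity (\sum_(i in ~: S) F i).
  by rewrite [RHS]big_enum_val; apply: eq_bigr => i _; rewrite /F !mxE.
rewrite (eq_bigr (fun i => (if i == enum_val j
    then y i * #|[set k | e i k]|%:R else 0) - (if e i (enum_val j) then y i else 0))).
  rewrite sumrB -!big_mkcondr; congr (_ - _).
  rewrite (big_pred1 (enum_val j)) // => i /=.
  by apply/andb_idl => /eqP ->; apply: enum_valP.
move=> i _; rewrite /F !mxE mulrBr; congr (_ - _).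
  by case: eqP => [->|_]; rewrite ?mulr1n // mulr0n mulr0.
by case: (e _ _); rewrite ?mulr1 ?mulr0.
Qed.

Lemma card_neighbours_split (n : nat) (e : rel 'I_n) (S : {set 'I_n}) (j : 'I_n) :
  #|[set k | e j k]| = (#|[set k in S | e j k]| + #|[set k in ~: S | e j k]|)%N.
Proof.
rewrite -[LHS](cardsID S); congr addn; apply: eq_card => k;
  by rewrite !inE andbC.
Qed.

Lemma grounded_eigenvalue_ge (R : realType) (n : nat) (e : rel 'I_n)
    (S : {set 'I_n}) (c : nat) :
  symmetric e -> S \proper [set: 'I_n] ->
  (forall i, i \notin S -> (c <= #|[set k in S | e i k]|)%N) ->
  c%:R <= grounded_eigenvalue R e S.
Proof.
move=> sym_e propS cS.
have [/eigenvalueP[x xL x_neq0] _] := grounded_eigenvalueP R sym_e propS.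
set a := grounded_eigenvalue R e S in xL *.
have [j0 xj0] : exists j, x 0 j != 0 by apply/rV0Pn.
have [j _ maxj] : extremum_spec (>=%R) xpredT (fun j => `|x 0 j|)
    [arg max_(j > j0) `|x 0 j|]%O by apply: arg_maxP.
have xj_gt0 : 0 < `|x 0 j| by apply: lt_le_trans (maxj j0 isT); rewrite normr_gt0.
(* Extension of [x] by zero to all vertices: the sum has at most one term, and none on [S]. *)
pose y i : R := \sum_(l | enum_val l == i) x 0 l.
have yE l : y (enum_val l) = x 0 l.
  by rewrite /y (big_pred1 l) // => i /=; rewrite (inj_eq enum_val_inj).
have := congr1 (fun u : 'rV_#|~: S| => u 0 j) xL.
have -> : x = \row_i y (enum_val i) by apply/rowP => i; rewrite mxE yE.
rewrite mul_grounded_laplacian_mxE !mxE.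
set v := enum_val j => /eqP; rewrite subr_eq addrC -subr_eq => /eqP jE.
have vS : v \notin S by have := enum_valP j; rewrite inE.
have {maxj} maxy i : i \in ~: S -> `|y i| <= `|y v|.
  by move=> iS; rewrite -(enum_rankK_in iS iS) !yE; apply: maxj.
have {xj_gt0} yv_gt0 : 0 < `|y v| by rewrite yE.
set d := #|_| in jE.
(* By [jE] and maximality at [v], [|y v| * |d - a|] is at most [|y v|] times the number of
   ungrounded neighbours of [v]; then [|y v|] cancels. *)
have le_da : d%:R - a <= #|[set k in ~: S | e v k]|%:R.
  apply: le_trans (ler_norm _) _.
  rewrite -(ler_pM2l yv_gt0) -normrM mulrBr [y v * a]mulrC jE.
  apply: le_trans (ler_norm_sum _ _ _) _.
  rewrite mulr_natr -sumr_const big_set /=.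
  rewrite [leRHS](eq_bigl (fun k => (k \in ~: S) && e k v)); last first.
    by move=> k; rewrite unfold_in sym_e.
  by apply: ler_sum => i /andP[iS _]; apply: maxy.
move: le_da; rewrite /d (card_neighbours_split _ _ S) natrD lerBlDr addrC lerD2l.
by apply: le_trans; rewrite ler_nat cS.
Qed.

Lemma grounded_eigenvalue_le (R : realType) (n : nat) (e : rel 'I_n)
    (S T : {set 'I_n}) (c : nat) :
  symmetric e -> T != set0 -> T \subset ~: S ->
  (forall i j, i \in T -> j \in ~: S -> e i j -> j \in T) ->
  (forall i, i \in T -> #|[set k in S | e i k]| = c) ->
  grounded_eigenvalue R e S <= c%:R.
Proof.
move=> sym_e /set0Pn[t tT] /subsetP TS closedT cT.
have propS : S \proper [set: 'I_n].
  by apply/properP; split; [exact: subsetT | exists t; rewrite -?in_setC ?TS].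
have [_] := grounded_eigenvalueP R sym_e propS; apply.
pose y i : R := (i \in T)%:R.
apply/eigenvalueP; exists (\row_i y (enum_val i)); last first.
  apply/rV0Pn; exists (enum_rank_in (TS t tT) t).
  by rewrite mxE enum_rankK_in ?TS // /y tT oner_neq0.
apply/rowP => j; rewrite mul_grounded_laplacian_mxE !mxE.
set v := enum_val j; have vS : v \in ~: S by apply: enum_valP.
rewrite /y; have [vT|vT] := boolP (v \in T); last first.
  (* Off [T] both sides vanish: a neighbour of [v] in [T] would force [v] into [T]. *)
  rewrite mul0r mulr0 sub0r big1 ?oppr0 // => i /andP[iS iv].
  by apply/eqP; rewrite pnatr_eq0 eqb0; apply: contra vT => iT; apply: closedT iv.
(* On [T] every ungrounded neighbour of [v] lies in [T], so the sum cancels their share of the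
   degree and leaves [c]. *)
rewrite mul1r mulr1 (card_neighbours_split _ _ S) cT // natrD.
apply/eqP; rewrite subr_eq; apply/eqP; congr (_ + _).
rewrite -sumr_const big_set /=.
apply: eq_big => [i|i]; rewrite unfold_in; first by rewrite sym_e.
by case/andP=> iS vi; rewrite (closedT v).
Qed.

(** Among distinct nonzero vertices, [i + j == 3] singles out the edge between 1 and 2. *)
Definition paw : rel 'I_4 :=
  fun i j => (i != j) && ((i == 0) || (j == 0) || (i + j == 3)%N).

Lemma paw_connected : connected_simple_graph paw.
Proof.
have sym_paw : symmetric paw.
  by move=> i j; rewrite /paw eq_sym addnC [(i == 0) || _]orbC.
split=> //; first by move=> i; rewrite /paw eqxx.
have conn0 i : connect paw 0 i.
  have [<-|i0] := eqVneq 0 i; first exact: connect0.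
  by apply: connect1; rewrite /paw i0.
by move=> i j; apply: connect_trans (conn0 j); rewrite sym_connect_sym.
Qed.

Theorem mainTheorem1 (R : realType) :
  exists (n : nat) (e : rel 'I_n) (A B : {set 'I_n}) (v : 'I_n),
    [/\ connected_simple_graph e,
        A != set0 /\ B != set0,
        A \subset B /\ B \proper [set: 'I_n],
        v |: B \proper [set: 'I_n] &
        grounded_eigenvalue R e (v |: A) - grounded_eigenvalue R e A
          < grounded_eigenvalue R e (v |: B) - grounded_eigenvalue R e B].
Proof.
have [sym_e _ _] := paw_connected.
pose v3 : 'I_4 := @Ordinal 4 3 isT; pose v1 : 'I_4 := @Ordinal 4 1 isT.
have proper4 (S : {set 'I_4}) i : i \notin S -> S \proper [set: 'I_4].
  by move=> iS; apply/properP; split; [exact: subsetT | exists i].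
exists 4%N, paw, [set 0], [set 0; v3], v1; split; first exact: paw_connected.
- by split; apply/set0Pn; exists 0; rewrite !inE.
- by split; [rewrite subsetUl | apply: (@proper4 _ v1); rewrite !inE].
- by apply: (@proper4 _ (@Ordinal 4 2 isT)); rewrite !inE.
have leAv : grounded_eigenvalue R paw (v1 |: [set 0]) <= 1%:R.
  apply: (@grounded_eigenvalue_le _ _ _ _ [set v3]) => //.
  - by apply/set0Pn; exists v3; rewrite !inE.
  - by apply/subsetP => i; rewrite !inE => /eqP ->.
  - by move=> i j; rewrite !inE => /eqP ->; case: j => [[|[|[|[|]]]]].
  move=> i; rewrite !inE => /eqP ->.
  by rewrite -sum1dep_card big_mkcond !big_ord_recl big_ord0 !inE.
have geA : 1%:R <= grounded_eigenvalue R paw [set 0].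
  apply: grounded_eigenvalue_ge => //.
    by apply: (@proper4 _ v1); rewrite !inE.
  case=> [[|[|[|[|]]]]] // lti; rewrite !inE // => _;
  by rewrite -sum1dep_card big_mkcond !big_ord_recl big_ord0 !inE.
(* Vertices 1 and 2 form the remaining component; each has 0 as its only grounded neighbour. *)
have leB : grounded_eigenvalue R paw [set 0; v3] <= 1%:R.
  apply: (@grounded_eigenvalue_le _ _ _ _ [set v1; @Ordinal 4 2 isT]) => //.
  - by apply/set0Pn; exists v1; rewrite !inE.
  - by apply/subsetP => i; rewrite !inE => /orP[] /eqP ->.
  - by move=> i [[|[|[|[|]]]]] // j; rewrite !inE => /orP[] /eqP ->.
  by move=> i; rewrite !inE => /orP[] /eqP ->;
    rewrite -sum1dep_card big_mkcond !big_ord_recl big_ord0 !inE.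
(* Only vertex 2 remains, adjacent to both 0 and 1. *)
have geBv : 2%:R <= grounded_eigenvalue R paw (v1 |: [set 0; v3]).
  apply: grounded_eigenvalue_ge => //.
    by apply: (@proper4 _ (@Ordinal 4 2 isT)); rewrite !inE.
  case=> [[|[|[|[|]]]]] // lti; rewrite !inE // => _;
  by rewrite -sum1dep_card big_mkcond !big_ord_recl big_ord0 !inE.
(* Zero separates the two gains. *)
apply: (@le_lt_trans _ _ 0); first by rewrite subr_le0 (le_trans leAv).
by rewrite subr_gt0 (le_lt_trans leB) // (lt_le_trans _ geBv) // ltr_nat.
Qed.
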